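(* Let $\mathbb{X}$ be a minimal shift space over a finite alphabet, and let $\eta\colon \mathbb{N} \to [0,\infty)$ be an arbitrary non-decreasing function such that $\lim_{n\to\infty} \eta(n) = +\infty$. Then $\mathbb{X}$ has a string attractor $\Gamma$ such that $\#(\Gamma \cap [-n,n]) \le \eta(n)$ for all $n \in \mathbb{N}$.
   Context: $[j,k]$ denotes the set of integers $\{j,\dots,k\}$ and $x_{[j,k]} = x_j\cdots x_k$. A shift space is a subset of $\mathcal{A}^{\mathbb{Z}}$ ($\mathcal{A}$ a finite alphabet) that is closed for the product topology and stable under the shift $S\colon (x_i)_{i\in\mathbb{Z}}\mapsto (x_{i+1})_{i\in\mathbb{Z}}$. It is minimal if the only shift spaces it contains are itself and $\emptyset$. A set $\Gamma \subseteq \mathbb{Z}$ is a string attractor of a bi-infinite word $x$ if for every non-empty factor $w$ of $x$ (finite word occurring in $x$) there is $i \in \mathbb{Z}$ with $x_{[i,i+|w|-1]} = w$ and $[i,i+|w|-1]\cap\Gamma \ne \emptyset$. $\Gamma$ is a string attractor of a shift space $\mathbb{X}$ if it is a string attractor of every $x \in \mathbb{X}$. *)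

(* Defs.v *)
From mathcomp Require Import all_boot all_order all_algebra.
From mathcomp Require Import finmap.
From mathcomp Require Import all_classical all_reals all_analysis.

Set Implicit Arguments.
Unset Strict Implicit.
Unset Printing Implicit Defensive.

Import Order.TTheory GRing.Theory Num.Theory.
Import numFieldNormedType.Exports.

Local Open Scope classical_set_scope.
Local Open Scope ring_scope.

(* MathComp world, with MathComp-Analysis. *)

Definition biword (A : finType) : Type :=
  prod_topology (fun _ : int => discrete_topology A).

Definition shift (A : finType) (x : biword A) : biword A :=
  fun i => x (i + 1).

(* Stability is the inclusion S(X) `<=` X. For minimal shift spaces it
   amounts to S(X) = X, by compactness. *)
Definition is_shift_space (A : finType) (X : set (biword A)) : Prop :=
  closed X /\ @shift A @` X `<=` X.

(* By this definition, X = set0 is a minimal shift space. *)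
Definition is_minimal_shift_space (A : finType) (X : set (biword A)) : Prop :=
  is_shift_space X /\
  forall Y : set (biword A), is_shift_space Y -> Y `<=` X -> Y = X \/ Y = set0.

(* x_[i, i+n-1] = x_i ... x_(i+n-1) *)
Definition factor_at (A : finType) (x : biword A) (i : int) (n : nat) : seq A :=
  [seq x (i + k%:Z) | k <- iota 0 n].

Definition is_factor (A : finType) (x : biword A) (w : seq A) : Prop :=
  exists i : int, factor_at x i (size w) = w.

Definition int_interval (j k : int) : set int := [set i | j <= i <= k].

Definition is_word_attractor (A : finType) (G : set int) (x : biword A) : Prop :=
  forall w : seq A, w != [::] -> is_factor x w ->
    exists i : int, factor_at x i (size w) = w /\
      int_interval i (i + (size w)%:Z - 1) `&` G !=set0.

Definition is_shift_attractor (A : finType) (G : set int)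
    (X : set (biword A)) : Prop :=
  forall x, X x -> is_word_attractor G x.

(* Main.v *)
Require Import Defs.
From mathcomp Require Import all_boot all_order all_algebra.
From mathcomp Require Import finmap.
From mathcomp Require Import all_classical all_reals all_analysis.
From mathcomp Require Import zify.

(** In a minimal shift space X, recurrence is uniform over all of X: for each
    word w of the language of X there is a bound M such that every x in X has an
    occurrence of w starting in [-M, M] ([minimal_uniform_recurrence]).  Applied
    to the k-th shift of x, this gives an occurrence starting in [k - M, k + M],
    for any k >= 0.  So a block of 2M + 1 consecutive integers, placed anywhere
    far enough to the right, contains the start of an occurrence of w in every
    x in X at once.

    There are countably many words, hence countably many blocks to place, and
    the position of each block is free.  The block number m is placed at a
    distance n where eta n already exceeds the total size of the blocks
    0, ..., m; then no window [-n, n] meets blocks of total size more than eta n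
    ([sparse_blocks]).  The union of the blocks is the required attractor. *)

Import Order.TTheory GRing.Theory Num.Theory.
Import numFieldNormedType.Exports.
Local Open Scope classical_set_scope.
Local Open Scope ring_scope.

Lemma factor_at_near (A : finType) (x : biword A) (i : int) (n : nat) :
  \forall y \near x, factor_at y i n = factor_at x i n.
Proof.
rewrite /factor_at; elim: (iota 0 n) => [|k s IHs] /=; first exact: filterE.
have near_coord : \forall y \near x, y (i + k%:Z) = x (i + k%:Z).
  exact: (@proj_continuous _ (fun=> discrete_topology A) (i + k%:Z) x
    [set x (i + k%:Z)] (discrete_set1 _)).
by apply: filterS2 IHs near_coord => y -> ->.
Qed.

Lemma open_occurrence (A : finType) (w : seq A) (i : int) :
  open [set x : biword A | factor_at x i (size w) = w].
Proof.
rewrite openE => x /= xw; have := factor_at_near A x i (size w).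
by apply: filterS => y /= ->.
Qed.

Lemma compact_shift_space (A : finType) (X : set (biword A)) :
  is_shift_space X -> compact X.
Proof.
case=> Xcl _.
have full_compact := @tychonoff int (fun=> discrete_topology A) (fun=> setT)
  (fun=> @finite_compact (discrete_topology A) setT (@finite_finset A setT)).
by apply: (subclosed_compact Xcl full_compact) => x _ i.
Qed.

Lemma factor_at_shift (A : finType) (x : biword A) (k : nat) (i : int) (n : nat) :
  factor_at (iter k (@Defs.shift A) x) i n = factor_at x (i + k%:Z) n.
Proof.
elim: k i => [|k IHk] i; first by rewrite addr0.
rewrite iterS.
have -> : factor_at (Defs.shift (iter k (@Defs.shift A) x)) i n
        = factor_at (iter k (@Defs.shift A) x) (i + 1) n.
  by apply: eq_map => j; rewrite /Defs.shift; congr (iter _ _ _ _); lia.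
by rewrite IHk; congr factor_at; lia.
Qed.

Lemma iter_shift_mem (A : finType) (X : set (biword A)) (k : nat) x :
  is_shift_space X -> X x -> X (iter k (@Defs.shift A) x).
Proof.
case=> _ SX Xx; elim: k => //= k IHk.
by apply: SX; exists (iter k (@Defs.shift A) x).
Qed.

(** The points of X that avoid w form a proper sub-shift space, which minimality
    forces to be empty.  They are defined by avoidance at all positions, negative ones
    included, so that a single occurrence of w anywhere in a point of X makes
    the sub-shift proper. *)
Lemma minimal_factor_occurs (A : finType) (X : set (biword A)) (w : seq A) :
  is_minimal_shift_space X -> (exists2 x, X x & is_factor x w) ->
  forall x, X x -> is_factor x w.
Proof.
case=> -[Xcl SX] minX [z Xz [j zw]] x Xx.
pose Y := X `&` \bigcap_(i : int) ~` [set y | factor_at y i (size w) = w].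
have shiftY : is_shift_space Y.
  split.
    apply: closedI => //; apply: closed_bigI => i _.
    by apply: open_closedC; apply: open_occurrence.
  move=> _ [y [Xy avoid] <-]; split; first by apply: SX; exists y.
  move=> i _ /=; rewrite (factor_at_shift A y 1); exact: (avoid (i + 1)).
have [YX|Y0] := minX Y shiftY (@subIsetl _ _ _).
  by move: Xz; rewrite -YX => -[_ /(_ j I)].
apply: contrapT => nxw.
suff : Y x by rewrite Y0.
by split=> // i _ xw; apply: nxw; exists i.
Qed.

(** Having w at a given position is an open condition, so a bound that works for
    x works near x; compactness of X makes it uniform. *)
Lemma minimal_uniform_recurrence (A : finType) (X : set (biword A)) (w : seq A) :
  is_minimal_shift_space X -> (exists2 x, X x & is_factor x w) ->
  exists M : nat, forall x, X x ->
    exists2 i : int, (`|i| <= M)%N & factor_at x i (size w) = w.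
Proof.
move=> minX Xw.
pose P (M : nat) (x : biword A) :=
  exists2 i : int, (`|i| <= M)%N & factor_at x i (size w) = w.
have [M0 _ PM] : \forall M \near \oo, X `<=` P M.
  apply: ((iffLR (compact_near_coveringP _)) (compact_shift_space A X minX.1)).
  move=> x Xx; have [i xw] := minimal_factor_occurs A X w minX Xw x Xx.
  exists ([set y | factor_at y i (size w) = w], [set M | (`|i| <= M)%N]).
    split; last exact: nbhs_infty_ge.
    by apply: open_nbhs_nbhs; split => //; apply: open_occurrence.
  by move=> [y M] /= [yw iM]; exists i.
by exists M0 => x Xx; apply: PM => //=.
Qed.

Definition blocks (c L : nat -> nat) : set int :=
  \bigcup_m int_interval (c m)%:Z (c m + L m)%:Z.

(** The lengths [L] are imposed and only the positions [c] are chosen.  Placing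
    block m where eta has reached the total size T (m + 1) of the blocks up to
    m ensures that a window [-n, n] sees only blocks m with
    T (m + 1) <= eta n.  These are the blocks before the first q for which this
    fails, and their total size T q is at most eta n. *)
Lemma sparse_blocks (R : realType) (eta : nat -> R) (L : nat -> nat)
    (eta_ge0 : forall n : nat, 0 <= eta n)
    (eta_ndecr : forall m n : nat, (m <= n)%N -> eta m <= eta n)
    (eta_cvg : eta n @[n --> \oo] --> +oo) :
  exists c : nat -> nat, forall n : nat,
    (#|` fset_set (blocks c L `&` int_interval (- n%:Z) n%:Z)|)%:R <= eta n.
Proof.
pose T m := (\sum_(j < m) (L j).+1)%N.
have TS m : T m.+1 = (T m + (L m).+1)%N by rewrite /T big_ord_recr.
have T_mono : {homo T : m n / (m <= n)%N >-> (m <= n)%N}.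
  by apply: homo_leq => // [? ? ?|m]; [exact: leq_trans | rewrite TS leq_addr].
have T_ge m : (m <= T m)%N by elim: m => // m; rewrite TS; lia.
have /choice[c c_large] : forall m, exists n, (T m.+1)%:R <= eta n.
  move=> m; have /cvgryPge/(_ (T m.+1)%:R)[n _ eta_large] := eta_cvg.
  by exists n; apply: eta_large => /=.
exists c => n.
(* T (m + 1) > m, so eta n is exceeded eventually. *)
have /ex_minnP[q eta_lt q_min] : exists m, eta n < (T m.+1)%:R.
  exists (Num.bound (eta n)); apply: lt_le_trans (archi_boundP (eta_ge0 n)) _.
  by rewrite ler_nat ltnW.
have Tq_le : (T q)%:R <= eta n.
  case: q q_min {eta_lt} => [|q] q_min; first by rewrite /T big_ord0.
  by rewrite leNgt; apply/negP => /q_min; rewrite ltnn.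
apply: le_trans Tq_le; rewrite ler_nat.
pose s := flatten [seq [seq (c j + k)%:Z | k <- iota 0 (L j).+1] | j <- iota 0 q].
have size_s : size s = T q.
  rewrite size_flatten /shape -map_comp sumnE big_map -[in LHS](subn0 q).
  by rewrite big_mkord; apply: eq_bigr => j _; rewrite /= !size_map size_iota.
rewrite -size_s.
have sub_s : blocks c L `&` int_interval (- n%:Z) n%:Z `<=` [set` s].
  move=> i [[j _ /= /andP[ci iL]] /andP[_ in_]].
  have jq : (j < q)%N.
    rewrite ltnNge; apply/negP => qj.
    have : eta n < eta n; last by rewrite ltxx.
    apply: (lt_le_trans eta_lt).
    apply: le_trans (eta_ndecr (c j) n _); last by lia.
    by apply: le_trans (c_large j); rewrite ler_nat T_mono.
  apply/flatten_mapP; exists j; first by rewrite mem_iota.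
  apply/mapP; exists (`|i| - c j)%N; last by lia.
  by rewrite mem_iota; lia.
have fin_s : finite_set [set` s] by exact: finite_seq.
have fin_G := sub_finite_set sub_s fin_s.
have /fsubset_leq_card/leq_trans -> // :
  (fset_set (blocks c L `&` int_interval (- n%:Z) n%:Z) `<=` [fset i in s])%fset.
  apply/fsubsetP => i; rewrite in_fset_set// inE => /sub_s.
  by rewrite inE.
by rewrite card_fseq size_undup.
Qed.

Theorem proposition54 (R : realType) (A : finType) (X : set (biword A))
    (eta : nat -> R)
    (minX : is_minimal_shift_space X)
    (eta_ge0 : forall n : nat, 0 <= eta n)
    (eta_ndecr : forall m n : nat, (m <= n)%N -> eta m <= eta n)
    (eta_cvg : eta n @[n --> \oo] --> +oo) :
  exists G : set int, is_shift_attractor G X /\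
    forall n : nat,
      (#|` fset_set (G `&` int_interval (- n%:Z) n%:Z)|)%:R <= eta n.
Proof.
have /choice[M recM] : forall w : seq A, exists M : nat,
    (exists2 x, X x & is_factor x w) -> forall x, X x ->
    exists2 i : int, (`|i| <= M)%N & factor_at x i (size w) = w.
  move=> w; have [Xw|nXw] := pselect (exists2 x, X x & is_factor x w).
    by have [M HM] := minimal_uniform_recurrence A X w minX Xw; exists M.
  by exists 0%N.
pose L m := if @choice.unpickle (seq A) m is Some w then (M w).*2 else 0%N.
have [c sparse] := sparse_blocks R eta L eta_ge0 eta_ndecr eta_cvg.
exists (blocks c L); split=> // x Xx w w_neq0 xw.
(* With this k, the interval [k - M w, k + M w] is the block of w. *)
pose k := (c (choice.pickle w) + M w)%N.
have [i iM occ] := recM w (ex_intro2 _ _ x Xx xw) _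
  (iter_shift_mem A X k x minX.1 Xx).
exists (i + k%:Z); split; first by rewrite -factor_at_shift.
exists (i + k%:Z); split.
  by move: w_neq0; rewrite -size_eq0 /int_interval /=; lia.
exists (choice.pickle w) => //; rewrite /int_interval /L choice.pickleK /= /k; lia.
Qed.
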